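(* For any fixed integer $d\geq 1$, the integrality gap of the spreading LP for the unbounded version of $d$-dimAP+ is $\Omega(k^{1/(2d)})$; that is, there is a constant $c>0$ (depending on $d$) such that for infinitely many $k$ there are instances of unbounded $d$-dimAP+ with $k$ terminals whose optimal integral cost is at least $c\,k^{1/(2d)}$ times the optimal LP value.
   Context: Unbounded $d$-dimAP+: the input is a graph $G=(V,E)$, nonnegative edge weights $w$, terminals $T\subseteq V$ with $|T|=k$, and an injective $f_0:T\to\mathbb{Z}^d$; a feasible solution is an injective $f:V\to\mathbb{Z}^d$ with $f|_T=f_0$, of cost $\sum_{\{u,v\}\in E}w_{uv}\|f(u)-f(v)\|_2$, to be minimized. The spreading LP has as variables a metric $d$ on $V$ and is: minimize $\sum_{\{u,v\}\in E}w_{uv}\,d(u,v)$ subject to $\sum_{v\in S}d(u,v)\geq (|S|-1)^{1+1/d}/4$ for all $S\subseteq V$ and $u\in S$, and $d(u,v)=\|f_0(u)-f_0(v)\|_2$ for all $u,v\in T$. The integrality gap is the supremum over instances of the ratio of the optimal integral cost to the optimal LP value. *)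

(* Defs.v *)
From HB Require Import structures.
From mathcomp Require Import all_boot all_order all_algebra.
From mathcomp Require Import all_classical all_reals all_analysis.

Set Implicit Arguments.
Unset Strict Implicit.
Unset Printing Implicit Defensive.

Import Order.TTheory GRing.Theory Num.Theory.

Local Open Scope classical_set_scope.
Local Open Scope ring_scope.

(* The library norm on 'rV is the sup norm, hence this definition. *)
Definition l2dist (R : realType) (d : nat) (p q : 'rV[int]_d) : R :=
  Num.sqrt (\sum_(i < d) ((p ord0 i - q ord0 i)%:~R) ^+ 2).

(* [fixpos] is only meaningful on [terminals], and [weight] only on edges. *)
Record instance (R : realType) (d : nat) := Instance {
  vertex : finType;
  edge : rel vertex;
  edge_sym : symmetric edge;
  edge_irrefl : irreflexive edge;
  weight : vertex -> vertex -> R;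
  weight_sym : forall u v, edge u v -> weight u v = weight v u;
  weight_ge0 : forall u v, edge u v -> 0 <= weight u v;
  terminals : {set vertex};
  fixpos : vertex -> 'rV[int]_d;
  fixpos_inj : {in terminals &, injective fixpos}
}.

(* Each undirected edge is summed in both orientations, hence the factor 1/2. *)
Definition edge_cost (R : realType) (d : nat) (I : instance R d)
    (len : vertex I -> vertex I -> R) : R :=
  2^-1 * \sum_(p : vertex I * vertex I | edge p.1 p.2)
           weight p.1 p.2 * len p.1 p.2.

Definition feasible (R : realType) (d : nat) (I : instance R d)
    (f : vertex I -> 'rV[int]_d) : Prop :=
  injective f /\ {in terminals I, f =1 @fixpos R d I}.

Definition placement_cost (R : realType) (d : nat) (I : instance R d)
    (f : vertex I -> 'rV[int]_d) : R :=
  edge_cost (fun u v => l2dist R (f u) (f v)).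

Definition is_metric (R : realType) (V : Type) (m : V -> V -> R) : Prop :=
  [/\ forall u v, 0 <= m u v,
      forall u v, m u v = 0 <-> u = v,
      forall u v, m u v = m v u &
      forall u v t, m u t <= m u v + m v t].

Definition lp_feasible (R : realType) (d : nat) (I : instance R d)
    (m : vertex I -> vertex I -> R) : Prop :=
  [/\ is_metric m,
      forall (S : {set vertex I}) (u : vertex I), u \in S ->
        (#|S|.-1)%:R `^ (1 + d%:R^-1) / 4 <= \sum_(v in S) m u v &
      {in terminals I &, forall u v, m u v = l2dist R (fixpos u) (fixpos v)}].

(* Both problems attain their minimum, so the infima are the optimal values.
   [inf set0 = 0], hence a positive value of either optimum below entails that the
   corresponding problem is feasible. *)
Definition opt_value (R : realType) (d : nat) (I : instance R d) : R :=
  inf [set placement_cost f | f in @feasible R d I].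

Definition lp_value (R : realType) (d : nat) (I : instance R d) : R :=
  inf [set edge_cost m | m in @lp_feasible R d I].

(* Instances of LP value 0 have no meaningful ratio: the spreading constraints
   for two-point sets force m u v >= 1/4 for u != v, so all their edge weights
   vanish and their integral optimum is 0 too. *)
Definition integrality_gap (R : realType) (d k : nat) : \bar R :=
  ereal_sup [set r | exists I : instance R d,
    [/\ #|terminals I| = k, 0 < lp_value I &
        r = (opt_value I / lp_value I)%:E]].

(* Main.v *)
Require Import Defs.
From HB Require Import structures.
From mathcomp Require Import all_boot all_order all_algebra.
From mathcomp Require Import all_classical all_reals all_analysis.
From mathcomp Require Import zify ring lra.

Set Implicit Arguments.
Unset Strict Implicit.
Unset Printing Implicit Defensive.

Import Order.TTheory GRing.Theory Num.Theory.

Local Open Scope classical_set_scope.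
Local Open Scope ring_scope.

(* The terminals occupy every lattice point of a cube of side [2 n + 1], and a
   single nonterminal is joined by an edge to the central terminal. Any placement
   must put the nonterminal outside the cube, at cost at least [n + 1], whereas
   the LP may put it at distance 1 from the centre. To see that the resulting
   metric is spreading, compare it from below with the sup distance: a ball of
   integer radius [r] holds at most [(2 r + 1) ^ d] terminals and the nonterminal,
   so the [i]-th closest of the other points has a distance [r >= 1] with
   [i <= (2 r + 1) ^ d], and these lower bounds sum to the required amount.
   This gives a gap of [n + 1 >= k^(1/d) / 2 >= k^(1/(2d)) / 2]. *)

Lemma weighted_amgm (R : realDomainType) (d : nat) (a b : R) :
  0 <= a -> 0 <= b ->
  d.+1%:R * (a * b ^+ d) <= a ^+ d.+1 + d%:R * b ^+ d.+1.
Proof.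
move=> a0 b0; elim: d => [|d IH].
  by rewrite expr0 mulr1 mul1r expr1 mul0r addr0.
have cross : 0 <= (a ^+ d.+1 - b ^+ d.+1) * (a - b).
  have [ab|/ltW ba] := leP a b.
    by apply: mulr_le0; rewrite subr_le0 // lerXn2r.
  by apply: mulr_ge0; rewrite subr_ge0 // lerXn2r.
have := ler_wpM2r b0 IH.
rewrite [d.+2%:R]mulrS [d.+1%:R in X in _ -> X]mulrS.
rewrite [d.+1%:R]mulrS.
rewrite !(exprS _ d.+1) !(exprS _ d) in cross *.
move: (a ^+ d) (b ^+ d) cross => p q; nra.
Qed.

Section Spreading.
Variable R : realType.

Lemma powR_natVK (d y : nat) : (0 < d)%N -> (y%:R `^ (d%:R^-1)) ^+ d = y%:R :> R.
Proof.
move=> d0; rewrite -powR_mulrn ?powR_ge0 // -powRrM mulVf ?powRr1 //.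
by rewrite pnatr_eq0 -lt0n.
Qed.

Lemma powR_nat_1DV (d y : nat) : (0 < d)%N ->
  y%:R `^ (1 + d%:R^-1) = y%:R * y%:R `^ (d%:R^-1) :> R.
Proof.
move=> d0; have dV : 0 < (d%:R : R)^-1 by rewrite invr_gt0 ltr0n.
rewrite powRD ?powRr1 //.
by rewrite (gt_eqF (addr_gt0 ltr01 dV)).
Qed.

Lemma powR_natV_le (d y r : nat) : (0 < d)%N -> (y <= r ^ d)%N ->
  y%:R `^ (d%:R^-1) <= r%:R :> R.
Proof.
move=> d0 yr; rewrite -(@ler_pXn2r _ d) ?nnegrE ?powR_ge0 ?ler0n //.
by rewrite powR_natVK // -natrX ler_nat.
Qed.

Lemma powR_nat_1DV_step (d y : nat) : (0 < d)%N ->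
  d%:R * y.+1%:R `^ (1 + d%:R^-1) <=
  d%:R * y%:R `^ (1 + d%:R^-1) + d.+1%:R * y.+1%:R `^ (d%:R^-1) :> R.
Proof.
move=> d0; rewrite !powR_nat_1DV //.
have /= := weighted_amgm d (powR_ge0 y.+1%:R d%:R^-1) (powR_ge0 (y%:R : R) d%:R^-1).
rewrite !exprS !powR_natVK // -[y.+1%:R]natr1 -[d.+1%:R]natr1.
move: (powR _ _) (powR _ _) => a b; lra.
Qed.

Lemma sum_shell_dim1 (F : nat -> nat) (y : nat) :
  (forall i, 0 < F i)%N -> (forall i, i < 2 * F i + 1)%N ->
  (y.+1./2 * (uphalf y.+1) < \sum_(i < y.+1) F i)%N.
Proof.
move=> F0 Fi; elim: y => [|y IH].
  by rewrite big_ord_recr big_ord0 /=; exact: F0.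
rewrite big_ord_recr /=; move: IH (Fi y.+1) => /=.
rewrite uphalf_half; move: (odd_double_half y); case: (odd y) => /=; nia.
Qed.

(* Up to [y = 4 ^ d] each of the [y] distances being at least 1 suffices;
   beyond, the increment [(1 + 1/d) y^(1/d) / 4] is at most
   [3 (2 r + 1) / 8 <= r] because [r >= 2]. In dimension 1 that last estimate
   fails and integrality of the distances has to be exploited. *)
Lemma sum_shell_ge (d y : nat) (F : nat -> nat) : (0 < d)%N ->
  (forall i, 0 < F i)%N -> (forall i, i < (2 * F i + 1) ^ d)%N ->
  y%:R `^ (1 + d%:R^-1) / 4 <= (\sum_(i < y) F i)%:R :> R.
Proof.
move=> d0 F0 Fi.
have [d1|d1|d1] := ltngtP d 1%N; first by lia.
  elim: y => [|y IH].
    by rewrite powR_nat_1DV // mul0r mul0r.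
  have [y4|y4] := leqP y.+1 (4 ^ d).
    rewrite powR_nat_1DV //.
    have le_sum : (y.+1 <= \sum_(i < y.+1) F i)%N.
      rewrite -[X in (X <= _)%N]card_ord -sum1_card.
      by apply: leq_sum => i _; exact: F0.
    apply: le_trans (_ : y.+1%:R <= _); last by rewrite ler_nat.
    have := powR_natV_le d0 y4.
    have : 0 <= y.+1%:R :> R by [].
    move: (powR _ _) => a; nra.
  rewrite big_ord_recr /= natrD.
  have F2 : (2 <= F y)%N.
    have : (4 ^ d < (2 * F y + 1) ^ d)%N by move: (Fi y); lia.
    by rewrite ltn_exp2r //; lia.
  have := powR_natV_le d0 (Fi y).
  have := powR_nat_1DV_step y d0.
  have d2 : 2 <= d%:R :> R by rewrite ler_nat.
  have F2R : 2 <= (F y)%:R :> R by rewrite ler_nat.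
  rewrite -[d.+1%:R]natr1 natrD natrM.
  move: IH; set A := powR _ (1 + _); set B := powR _ (1 + _) => IH step ale.
  have a0 : 0 <= y.+1%:R `^ (d%:R)^-1 :> R by exact: powR_ge0.
  move: (powR _ _) a0 step ale => a a0 step ale.
  have : d%:R * B <= d%:R * (A + 4 * (F y)%:R) by nra.
  rewrite ler_pM2l; lra.
rewrite powR_nat_1DV // d1 invr1 powRr1 //.
case: y => [|y]; first by rewrite mul0r mul0r.
have Fi1 i : (i < 2 * F i + 1)%N by have := Fi i; rewrite d1 expn1.
have := @sum_shell_dim1 F y F0 Fi1; move: (\sum_(i < _) _)%N => s.
have := odd_double_half y.+1; rewrite uphalf_half.
move: (y.+1) (y.+1./2) => z h zh hs.
have : (z * z <= 4 * s)%N by move: zh hs; case: (odd z) => /=; nia.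
rewrite -(ler_nat R) !natrM; lra.
Qed.

Lemma ex_farthest (V : finType) (D : V -> nat) (S : {set V}) (u : V) :
  u \in S -> D u = 0%N -> (1 < #|S|)%N ->
  exists w, [/\ w \in S, w != u & forall x, x \in S -> (D x <= D w)%N].
Proof.
move=> uS Du0 S1.
have [w0 w0S] : exists w, w \in S :\ u.
  by apply/set0Pn; rewrite -card_gt0; move: S1; rewrite (cardsD1 u) uS; lia.
have [w wS wmax] := @arg_maxnP _ w0 (mem (S :\ u)) D w0S.
move: wS; rewrite /= !inE => /andP[wu wS]; exists w; split=> // x xS.
have [->|xu] := eqVneq x u; first by rewrite Du0.
by apply: wmax; rewrite /= !inE xu.
Qed.

Lemma sum_dist_ge (V : finType) (D : V -> nat) (d : nat) (S : {set V}) (u : V)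
    (F : nat -> nat) : u \in S -> D u = 0%N ->
  (forall w, w != u -> (0 < D w)%N) ->
  (forall r, #|[pred w | (D w <= r)%N]| <= ((2 * r + 1) ^ d).+1)%N ->
  (forall i r, 0 < r -> i < (2 * r + 1) ^ d -> F i <= r)%N ->
  (\sum_(i < #|S|.-1) F i <= \sum_(w in S) D w)%N.
Proof.
move=> + Du0 Dpos ball Fmin.
move: {2}#|S| (leqnn #|S|) => m; elim: m S => [|m IH] S Sm uS.
  by move: Sm; rewrite leqn0 cards_eq0 => /eqP S0; rewrite S0 inE in uS.
have [S1|S1] := leqP #|S| 1.
  by have -> : #|S|.-1 = 0%N by [lia]; rewrite big_ord0.
have [w [wS wu wmax]] := ex_farthest uS Du0 S1.
have cS : #|S| = #|S :\ w|.+1 by rewrite (cardsD1 w S) wS.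
have uSw : u \in S :\ w by rewrite !inE uS eq_sym wu.
have Sw0 : (0 < #|S :\ w|)%N by apply/card_gt0P; exists u.
have {}IH := IH (S :\ w) ltac:(lia) uSw.
have cSle : (#|S| <= ((2 * D w + 1) ^ d).+1)%N.
  apply: leq_trans (ball (D w)).
  by apply/subset_leq_card/fintype.subsetP => x xS; rewrite inE; exact: wmax.
have -> : (\sum_(x in S) D x = D w + \sum_(x in S :\ w) D x)%N.
  by rewrite (bigD1 w) //=; congr addn; apply: eq_bigl => x; rewrite !inE andbC.
move: IH cSle; rewrite cS; case: #|S :\ w| Sw0 => // y _ IH cSle.
rewrite big_ord_recr /= addnC leq_add //.
by apply: Fmin; [exact: Dpos | lia].
Qed.

Lemma spreading_nat (V : finType) (D : V -> nat) (d : nat) (S : {set V}) (u : V) :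
  (0 < d)%N -> u \in S -> D u = 0%N ->
  (forall w, w != u -> (0 < D w)%N) ->
  (forall r, #|[pred w | (D w <= r)%N]| <= ((2 * r + 1) ^ d).+1)%N ->
  (#|S|.-1)%:R `^ (1 + d%:R^-1) / 4 <= (\sum_(w in S) D w)%:R :> R.
Proof.
move=> d0 uS Du0 Dpos ball.
have ex_shell i : exists r, (0 < r)%N && (i < (2 * r + 1) ^ d)%N.
  exists i.+1; apply/andP; split=> //.
  apply: leq_trans (leq_pexp2l _ d0); lia.
pose F i := ex_minn (ex_shell i).
have FP i : (0 < F i)%N /\ (i < (2 * F i + 1) ^ d)%N.
  by rewrite /F; case: ex_minnP => r /andP[].
apply: le_trans (sum_shell_ge _ d0 (fun i => (FP i).1) (fun i => (FP i).2)) _.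
rewrite ler_nat; apply: sum_dist_ge uS Du0 Dpos ball _ => i r r0 ir.
by rewrite /F; case: ex_minnP => s _; apply; rewrite r0.
Qed.

End Spreading.

Section EuclideanDistance.
Variable R : realType.

Lemma cauchy_schwarz_sum (I : finType) (x y : I -> R) :
  \sum_i x i * y i <= Num.sqrt (\sum_i x i ^+ 2) * Num.sqrt (\sum_i y i ^+ 2).
Proof.
have sq_ge0 (z : I -> R) : 0 <= \sum_i z i ^+ 2.
  by apply: sumr_ge0 => i _; exact: sqr_ge0.
have zero (z t : I -> R) : \sum_i z i ^+ 2 = 0 -> \sum_i z i * t i = 0.
  move=> z0; apply: big1 => i _.
  have /eqP := psumr_eq0P (fun j _ => sqr_ge0 (z j)) z0 (i := i) isT.
  by rewrite sqrf_eq0 => /eqP ->; rewrite mul0r.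
have [x0|xn0] := eqVneq (\sum_i x i ^+ 2) 0.
  by rewrite zero // mulr_ge0 ?sqrtr_ge0.
have [y0|yn0] := eqVneq (\sum_i y i ^+ 2) 0.
  under eq_bigr do rewrite mulrC.
  by rewrite zero // mulr_ge0 ?sqrtr_ge0.
have a0 : 0 < Num.sqrt (\sum_i x i ^+ 2) by rewrite sqrtr_gt0 lt0r xn0 sq_ge0.
have b0 : 0 < Num.sqrt (\sum_i y i ^+ 2) by rewrite sqrtr_gt0 lt0r yn0 sq_ge0.
have a2 := sqr_sqrtr (sq_ge0 x); have b2 := sqr_sqrtr (sq_ge0 y).
move: (Num.sqrt _) (Num.sqrt _) a0 b0 a2 b2 => b a a0 b0 a2 b2.
have : 0 <= \sum_i (b * x i - a * y i) ^+ 2 := sq_ge0 _.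
have -> : \sum_i (b * x i - a * y i) ^+ 2 =
    b ^+ 2 * (\sum_i x i ^+ 2) + a ^+ 2 * (\sum_i y i ^+ 2)
    - 2 * (a * b) * \sum_i x i * y i.
  rewrite !mulr_sumr -big_split -sumrB; apply: eq_bigr => i _ /=; ring.
rewrite -a2 -b2; move: (\sum_i _) => s.
have ab0 : 0 < 2 * (a * b) by rewrite !mulr_gt0.
move=> H; rewrite -(ler_pM2l ab0); move: H. lra.
Qed.

Variable d : nat.
Implicit Types p q s : 'rV[int]_d.

Lemma l2dist_ge0 p q : 0 <= l2dist R p q.
Proof. exact: sqrtr_ge0. Qed.

Lemma l2distC p q : l2dist R p q = l2dist R q p.
Proof.
by congr Num.sqrt; apply: eq_bigr => i _; rewrite -sqrrN -rmorphN opprB.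
Qed.

Lemma l2dist_eq0 p q : l2dist R p q = 0 <-> p = q.
Proof.
split=> [/eqP|->]; last first.
  by rewrite /l2dist big1 ?sqrtr0 // => i _; rewrite subrr expr0n.
rewrite sqrtr_eq0 => le0; apply/rowP => i.
have /psumr_eq0P : \sum_(i < d) ((p ord0 i - q ord0 i)%:~R : R) ^+ 2 = 0.
  by apply/eqP; rewrite eq_le le0 sumr_ge0 // => j _; exact: sqr_ge0.
move=> /(_ (fun j _ => sqr_ge0 _) i isT)/eqP.
by rewrite sqrf_eq0 intr_eq0 subr_eq0 => /eqP.
Qed.

Lemma l2dist_triangle p q s : l2dist R p s <= l2dist R p q + l2dist R q s.
Proof.
rewrite -(@ler_pXn2r _ 2) ?nnegrE ?addr_ge0 ?l2dist_ge0 // sqrrD.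
have sq_ge0 t t' : 0 <= \sum_(i < d) ((t ord0 i - t' ord0 i)%:~R : R) ^+ 2.
  by apply: sumr_ge0 => i _; exact: sqr_ge0.
have -> : l2dist R p s ^+ 2 = l2dist R p q ^+ 2 + l2dist R q s ^+ 2 +
   (\sum_(i < d) (p ord0 i - q ord0 i)%:~R * (q ord0 i - s ord0 i)%:~R) *+ 2.
  rewrite /l2dist !sqr_sqrtr ?sq_ge0 // -mulr_natl mulr_sumr -!big_split.
  apply: eq_bigr => i _ /=; rewrite !rmorphB /=; ring.
have := cauchy_schwarz_sum (fun i => (p ord0 i - q ord0 i)%:~R)
                           (fun i => (q ord0 i - s ord0 i)%:~R).
rewrite -/(l2dist R p q) -/(l2dist R q s) !mulr2n; lra.
Qed.

Lemma l2dist_ge_coord p q i : (absz (p ord0 i - q ord0 i))%:R <= l2dist R p q.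
Proof.
rewrite natr_absz intr_norm -sqrtr_sqr /l2dist ler_wsqrtr //.
rewrite (bigD1 i) //= lerDl.
by apply: sumr_ge0 => j _; exact: sqr_ge0.
Qed.

End EuclideanDistance.

Section FullCube.
Variables (R : realType) (d n : nat).

(* [Some g] is the terminal at the lattice point [g] of the cube, and [None]
   the only nonterminal. *)
Definition cube_vertex : finType := option {ffun 'I_d -> 'I_(2 * n).+1}.

Implicit Types u v w : cube_vertex.

Definition cube_centre : cube_vertex := Some [ffun=> inord n].

(* The LP solution puts the nonterminal next to the centre, hence its
   coordinates here. *)
Definition cube_coord v (i : 'I_d) : nat := if v is Some g then g i else n.

Definition cube_pos v : 'rV[int]_d := \row_i (cube_coord v i)%:Z.

Definition cube_edge : rel cube_vertex :=
  fun u v => [|| (u, v) == (None, cube_centre) | (u, v) == (cube_centre, None)].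

Lemma cube_edge_sym : symmetric cube_edge.
Proof.
by move=> u v; rewrite /cube_edge !xpair_eqE orbC; congr orb; rewrite andbC.
Qed.

Lemma cube_edge_irrefl : irreflexive cube_edge.
Proof. by move=> [u|]; rewrite /cube_edge !xpair_eqE /= ?andbF. Qed.

Lemma cube_pos_inj : {in [set v : cube_vertex | isSome v]%SET &, injective cube_pos}.
Proof.
move=> [g|] [h|]; rewrite !inE //= => _ _ /rowP gh.
congr Some; apply/ffunP => i; apply: val_inj.
by have := gh i; rewrite !mxE /= => -[].
Qed.

Definition cube_instance : instance R d :=
  @Instance R d cube_vertex cube_edge cube_edge_sym cube_edge_irrefl
    (fun _ _ => 1) (fun _ _ _ => erefl) (fun _ _ _ => ler01)
    [set v : cube_vertex | isSome v]%SET cube_pos cube_pos_inj.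

Lemma card_cube_terminals : #|terminals cube_instance| = ((2 * n).+1 ^ d)%N.
Proof.
have -> : terminals cube_instance = Some @: [set: {ffun 'I_d -> 'I_(2 * n).+1}]%SET.
  apply/setP => -[g|]; rewrite !inE /=; first by rewrite imset_f ?inE.
  by apply/esym/imsetP => -[].
by rewrite card_imset ?cardsT ?card_ffun ?card_ord //; exact: Some_inj.
Qed.

Lemma cube_edge_cost (len : cube_vertex -> cube_vertex -> R) :
  (forall u v, len u v = len v u) ->
  @edge_cost R d cube_instance len = len None cube_centre.
Proof.
move=> lenC; rewrite /edge_cost /= (bigD1 (None, cube_centre)) /=; last by rewrite /cube_edge eqxx.
rewrite (bigD1 (cube_centre, None)) /=; last by rewrite /cube_edge eqxx orbT.
rewrite big1 ?addr0 ?mul1r; last first.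
  by move=> [u v]; rewrite /cube_edge /= -andbA => /and3P[/orP[]/eqP->]; rewrite eqxx.
by rewrite (lenC cube_centre); lra.
Qed.

Definition cube_metric u v : R :=
  l2dist R (cube_pos u) (cube_pos v) + (isSome u != isSome v)%:R.

Lemma cube_metric_is_metric : is_metric cube_metric.
Proof.
split=> [u v|u v|u v|u v t].
- by rewrite addr_ge0 ?l2dist_ge0.
- split=> [/eqP|->]; last first.
    by rewrite /cube_metric (l2dist_eq0 R _ _).2 // eqxx addr0.
  rewrite paddr_eq0 ?l2dist_ge0 // => /andP[/eqP/l2dist_eq0 uv].
  rewrite pnatr_eq0 eqb0 negbK.
  case: u v uv => [g|] [h|] //= gh _.
  by apply: cube_pos_inj; rewrite ?inE.
- by rewrite /cube_metric l2distC eq_sym.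
- have := l2dist_triangle R (cube_pos u) (cube_pos v) (cube_pos t).
  rewrite /cube_metric.
  have : (isSome u != isSome t)%:R <=
      (isSome u != isSome v)%:R + (isSome v != isSome t)%:R :> R.
    by rewrite -natrD ler_nat; case: u v t => [?|] [?|] [?|].
  lra.
Qed.

Definition cube_supdist u v : nat :=
  \max_(i < d) absz ((cube_coord u i)%:Z - (cube_coord v i)%:Z)
  + (isSome u != isSome v).

Lemma cube_supdist_le_metric u v : (cube_supdist u v)%:R <= cube_metric u v.
Proof.
rewrite natrD lerD2r.
apply: (big_ind (fun k : nat => k%:R <= l2dist R (cube_pos u) (cube_pos v))).
- exact: l2dist_ge0.
- by move=> x y xl yl; rewrite /maxn; case: ifP.
- move=> i _; apply: le_trans (l2dist_ge_coord R _ _ i).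
  by rewrite !mxE.
Qed.

Lemma cube_supdist_xx u : cube_supdist u u = 0%N.
Proof.
by rewrite /cube_supdist eqxx addn0 big1 // => i _; rewrite subrr.
Qed.

Lemma cube_supdist_gt0 u w : w != u -> (0 < cube_supdist u w)%N.
Proof.
apply: contraNltn; rewrite leqn0 addn_eq0 eqb0 negbK => /andP[max0 uw].
have {max0} eq_coord i : cube_coord u i = cube_coord w i.
  have := @leq_bigmax 'I_d (fun i => absz ((cube_coord u i)%:Z - (cube_coord w i)%:Z)) i.
  by rewrite (eqP max0); lia.
case: u w uw eq_coord => [g|] [h|] //= _ gh.
by apply/eqP; congr Some; apply/ffunP => i; apply: val_inj; rewrite /= gh.
Qed.

Lemma card_cube_ball u r :
  (#|[pred w | cube_supdist u w <= r]| <= ((2 * r + 1) ^ d).+1)%N.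
Proof.
pose phi (w : cube_vertex) : option {ffun 'I_d -> 'I_(2 * r).+1} :=
  omap (fun g : {ffun 'I_d -> 'I_(2 * n).+1} =>
          [ffun i => inord (g i + r - cube_coord u i)]) w.
have near w i : (cube_supdist u w <= r)%N ->
    (absz ((cube_coord u i)%:Z - (cube_coord w i)%:Z) <= r)%N.
  apply: leq_trans; apply: leq_trans (leq_addr _ _).
  exact: (@leq_bigmax 'I_d (fun i => absz ((cube_coord u i)%:Z - (cube_coord w i)%:Z))).
have phi_inj : {in [pred w | (cube_supdist u w <= r)%N] &, injective phi}.
  move=> [g|] [h|] //; rewrite !inE => ug uh [] /ffunP gh.
  congr Some; apply/ffunP => i; apply: val_inj => /=.
  have := near _ i ug; have := near _ i uh; have := congr1 val (gh i).
  rewrite !ffunE /= => + hi gi; rewrite !inordK; lia.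
rewrite -(card_in_image phi_inj); apply: leq_trans (max_card _) _.
by rewrite card_option card_ffun !card_ord addn1.
Qed.

Lemma cube_metric_feasible : (0 < d)%N -> @lp_feasible R d cube_instance cube_metric.
Proof.
move=> d0; split; first exact: cube_metric_is_metric.
- move=> S u uS.
  have := @spreading_nat R _ (cube_supdist u) d S u d0 uS (cube_supdist_xx u)
    (@cube_supdist_gt0 u) (card_cube_ball u).
  move=> /le_trans; apply; rewrite natr_sum.
  by apply: ler_sum => w _; exact: cube_supdist_le_metric.
- by move=> [g|] [h|]; rewrite ?inE //= => _ _; rewrite /cube_metric eqxx addr0.
Qed.

Lemma cube_pos_centre : cube_pos cube_centre = cube_pos None.
Proof. by apply/rowP => i; rewrite !mxE /= ffunE inordK //; lia. Qed.

Lemma cube_lp_le1 : (0 < d)%N -> lp_value cube_instance <= 1.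
Proof.
move=> d0; apply: ge_inf.
  exists 0 => _ [m [[m0 _ mC _] _ _] <-].
  by rewrite cube_edge_cost.
exists cube_metric; first exact: cube_metric_feasible.
rewrite cube_edge_cost; last by case: cube_metric_is_metric.
by rewrite /cube_metric cube_pos_centre (l2dist_eq0 R _ _).2 // add0r.
Qed.

Lemma cube_lp_gt0 : (0 < d)%N -> 0 < lp_value cube_instance.
Proof.
move=> d0; apply: lt_le_trans (_ : 4^-1 <= _); first by rewrite invr_gt0.
apply: lb_le_inf.
  by exists (edge_cost (I := cube_instance) cube_metric), cube_metric;
    [exact: cube_metric_feasible | ].
move=> _ [m [[m0 mE mC _] spread _] <-]; rewrite cube_edge_cost //.
have /spread : (None : cube_vertex) \in [set None; cube_centre]%SET.
  by rewrite !inE eqxx.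
rewrite cards2 /= powR1 big_setU1 ?inE //= big_set1.
by rewrite (mE None None).2 // add0r mul1r.
Qed.

(* All lattice points of the cube are occupied by terminals. *)
Lemma cube_placement_cost (f : cube_vertex -> 'rV[int]_d) :
  @feasible R d cube_instance f ->
  n.+1%:R <= placement_cost (I := cube_instance) f.
Proof.
move=> [finj fT]; rewrite /placement_cost cube_edge_cost; last by move=> u v; exact: l2distC.
rewrite (fT cube_centre) ?inE //= cube_pos_centre.
have [[i far]|near] := pselect (exists i,
    (n < absz (f None ord0 i - cube_pos None ord0 i))%N).
  by apply: le_trans (l2dist_ge_coord R _ _ i); rewrite ler_nat.
pose g : {ffun 'I_d -> 'I_(2 * n).+1} := [ffun i => inord (absz (f None ord0 i))].
suff : None = Some g by [].
apply: finj; rewrite (fT (Some g)) ?inE //=; apply/rowP => i.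
have : ~ (n < absz (f None ord0 i - cube_pos None ord0 i))%N.
  by move=> ni; apply: near; exists i.
rewrite !mxE /= ffunE; move: (f None ord0 i) => z /negP ni.
by rewrite inordK; lia.
Qed.

Lemma cube_opt_ge : (0 < d)%N -> n.+1%:R <= opt_value cube_instance.
Proof.
move=> d0; apply: lb_le_inf => [|_ [f ff <-]]; last exact: cube_placement_cost.
pose f (v : cube_vertex) : 'rV[int]_d :=
  if v is Some _ then cube_pos v else const_mx (-1).
exists (placement_cost (I := cube_instance) f), f => //; split; last first.
  by move=> [g|]; rewrite ?inE.
have far g : cube_pos (Some g) <> const_mx (-1).
  by move=> /rowP/(_ (Ordinal d0)); rewrite !mxE.
move=> [g|] [h|] //= gh.
- by apply: cube_pos_inj; rewrite ?inE.
- by have := far g gh.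
- by have := far h (esym gh).
Qed.

End FullCube.

Theorem theorem12 (R : realType) (d : nat) (hd : (1 <= d)%N) :
  exists c : R, 0 < c /\
    forall N : nat, exists k : nat, (N <= k)%N /\
      (exists I : instance R d,
         [/\ #|terminals I| = k,
             0 < lp_value I &
             c * k%:R `^ (2 * d%:R)^-1 * lp_value I <= opt_value I]) /\
      ((c * k%:R `^ (2 * d%:R)^-1)%:E <= integrality_gap R d k)%E.
Proof.
exists 2^-1; split=> [|N]; first by rewrite invr_gt0.
pose k := ((2 * N).+1 ^ d)%N.
have lp1 := cube_lp_le1 R N hd; have lp0 := cube_lp_gt0 R N hd.
have opt := cube_opt_ge R N hd; have cardk := card_cube_terminals R d N.
have d0 : 0 < d%:R :> R by rewrite ltr0n.
have k_le : k%:R `^ (2 * d%:R)^-1 <= (2 * N).+1%:R :> R.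
  apply: le_trans (powR_natV_le R hd (leqnn k)).
  apply: ler_powR; first by rewrite ler1n expn_gt0.
  by rewrite lef_pV2 ?posrE ?mulr_gt0 //; lra.
have gap : 2^-1 * k%:R `^ (2 * d%:R)^-1 * lp_value (cube_instance R d N) <=
    opt_value (cube_instance R d N).
  apply: le_trans opt; apply: le_trans (_ : 2^-1 * (2 * N).+1%:R <= _).
    apply: le_trans (ler_piMr _ lp1) _; first by rewrite mulr_ge0 ?powR_ge0 // invr_ge0.
    by rewrite ler_pM2l ?invr_gt0.
  rewrite -[(2 * N).+1%:R]natr1 natrM -[N.+1%:R]natr1; lra.
exists k; split; [|split].
- by apply: leq_trans (leq_pexp2l _ hd); rewrite ?expn1; lia.
- by exists (cube_instance R d N).
- apply: le_ereal_sup_tmp.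
  exists (opt_value (cube_instance R d N) / lp_value (cube_instance R d N))%:E.
    by exists (cube_instance R d N).
  by rewrite lee_fin ler_pdivlMr.
Qed.
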